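(* Let $n\ge 2$ be an integer and $\alpha>0$, $\alpha\ne \frac12$, be real. Consider solutions $u$ of the incompressible Navier--Stokes equations with dissipation $-(-\Delta)^\alpha$ in $\mathbb{R}^n$, and the scale transformations, for $\lambda>0$, $$u_\lambda(x,t)=\frac1\lambda\,u\!\left(\frac{x}{\lambda^{1/(2\alpha-1)}},\frac{t}{\lambda^{2\alpha/(2\alpha-1)}}\right),$$ which map solutions to solutions. The kinetic energy $\frac12\|u(\cdot,T)\|_{L^2}^2$ is critical under these scale transformations only for $\alpha=\alpha_L(n):=\frac{2+n}{4}$. That is, for solutions with finite nonzero kinetic energy at time $T$, the identity $$\tfrac12\big\|u_\lambda(\cdot,\lambda^{2\alpha/(2\alpha-1)}T)\big\|_{L^2}^2=\tfrac12\|u(\cdot,T)\|_{L^2}^2\qquad\text{for all }\lambda>0$$ holds precisely when $\alpha=\frac{2+n}{4}$.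
   Context: The equations are $\frac{\partial u}{\partial t}+u\cdot\nabla u+\nabla p=-(-\Delta)^{\alpha}u$, $\nabla\cdot u=0$, where $u$ is a time-dependent vector field on $\mathbb{R}^n$, $p$ is the pressure (determined by the divergence-free condition), and $(-\Delta)^\alpha$ is the Fourier multiplier with symbol $|k|^{2\alpha}$. The energy is called critical under scale transformations if it is invariant under $u\mapsto u_\lambda$, i.e. the energy $E_\lambda$ of $u_\lambda$ (at the correspondingly rescaled time) equals the energy $E$ of $u$ for all $\lambda$. *)

(* Defs.v *)
From HB Require Import structures.
From mathcomp Require Import all_boot all_order all_algebra.
From mathcomp Require Import complex.
From mathcomp Require Import all_classical all_reals all_analysis.

Set Implicit Arguments.
Unset Strict Implicit.
Unset Printing Implicit Defensive.

Import Order.TTheory GRing.Theory Num.Theory.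
Import numFieldNormedType.Exports.

Local Open Scope classical_set_scope.
Local Open Scope ring_scope.
Local Open Scope complex_scope.

(* Lebesgue measure on R^n, as the n-fold product of the one-dimensional
   measure. It lives on n-tuples, which carry the product sigma-algebra in
   the library; row vectors carry the topology but no sigma-algebra. *)

Section LebesgueStep.
Context (R : realType) (n : nat).
Local Notation T n := (n.-tuple (measurableTypeR R)).

Definition tuple_cons (p : measurableTypeR R * T n) : T n.+1 :=
  [tuple of p.1 :: p.2].

Lemma measurable_tuple_cons : measurable_fun [set: _] tuple_cons.
Proof.
apply: (@measurable_cons _ _ _ _ fst n snd); first exact: measurable_fst.
exact: measurable_snd.
Qed.

HB.instance Definition _ := isMeasurableFun.Build _ _ _ _ tuple_cons
  measurable_tuple_cons.

Variable m : {sigma_finite_measure set (T n) -> \bar R}.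

Definition lebesgue_step : set (T n.+1) -> \bar R :=
  pushforward (lebesgue_measure \x m)%E tuple_cons.

Let lebesgue_step0 : lebesgue_step set0 = 0%E.
Proof. exact: measure0. Qed.

Let lebesgue_step_ge0 A : (0 <= lebesgue_step A)%E.
Proof. exact: measure_ge0. Qed.

Let lebesgue_step_sigma_additive : semi_sigma_additive lebesgue_step.
Proof. exact: (@measure_semi_sigma_additive _ _ _
  (pushforward (lebesgue_measure \x m)%E tuple_cons)). Qed.

HB.instance Definition _ := isMeasure.Build _ _ _ lebesgue_step
  lebesgue_step0 lebesgue_step_ge0 lebesgue_step_sigma_additive.

Let lebesgue_step_sigma_finite : sigma_finite setT lebesgue_step.
Proof.
have /sigma_finiteP[F [TF ndF Foo]] := sigma_finiteT (@lebesgue_measure R).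
have /sigma_finiteP[G [TG ndG Goo]] := sigma_finiteT m.
pose g (t : T n.+1) : measurableTypeR R * T n := (thead t, [tuple of behead t]).
have gK : cancel tuple_cons g by case=> x t; congr (_, _); apply: val_inj.
have mg : measurable_fun [set: T n.+1] g.
  apply: measurable_fun_pair; first exact: measurable_tnth.
  exact: measurable_behead.
exists (fun i => g @^-1` (F i `*` G i)).
  apply/esym; rewrite -subTset => t _.
  have [k _ Fk] : (\bigcup_i F i) (g t).1 by rewrite -TF.
  have [l _ Gl] : (\bigcup_i G i) (g t).2 by rewrite -TG.
  exists (maxn k l) => //; split.
  - by move: Fk; exact/subsetPset/ndF/leq_maxl.
  - by move: Gl; exact/subsetPset/ndG/leq_maxr.
move=> i; have [? ?] := Foo i; have [? ?] := Goo i; split.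
  by rewrite -[X in measurable X]setTI; apply: mg => //; exact: measurableX.
rewrite /lebesgue_step /pushforward.
rewrite -comp_preimage (_ : g \o tuple_cons = id); last first.
  by apply/funext => p; exact: gK.
rewrite preimage_id.
by rewrite product_measure1E// lte_mul_pinfty// ge0_fin_numE.
Qed.

HB.instance Definition _ := Measure_isSigmaFinite.Build _ _ _ lebesgue_step
  lebesgue_step_sigma_finite.

End LebesgueStep.

Fixpoint lebesgue_Rn (R : realType) (n : nat) :
    {sigma_finite_measure set (n.-tuple (measurableTypeR R)) -> \bar R} :=
  if n is m.+1 then lebesgue_step (lebesgue_Rn R m)
  else \d_([tuple] : 0.-tuple (measurableTypeR R)).

Section EuclideanSpace.
Context (R : realType) (n : nat).
Implicit Types (x k : 'rV[R]_n) (f : 'rV[R]_n -> R) (g h : 'rV[R]_n -> R[i]).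

Definition vec (t : n.-tuple (measurableTypeR R)) : 'rV[R]_n :=
  \row_i tnth t i.

Definition dot x k : R := \sum_i x 0 i * k 0 i.

(* The library norm on matrices is the sup norm. *)
Definition enorm x : R := Num.sqrt (\sum_i x 0 i ^+ 2).

Definition basis_vec (i : 'I_n) : 'rV[R]_n := delta_mx 0 i.

Definition integrableC g : Prop :=
  (lebesgue_Rn R n).-integrable setT (fun t => (complex.Re (g (vec t)))%:E) /\
  (lebesgue_Rn R n).-integrable setT (fun t => (complex.Im (g (vec t)))%:E).

Definition integralC g : R[i] :=
  (\int[lebesgue_Rn R n]_t complex.Re (g (vec t))) +i*
  (\int[lebesgue_Rn R n]_t complex.Im (g (vec t))).

Definition iter_partial (s : seq 'I_n) f : 'rV[R]_n -> R :=
  foldr (fun i (df : 'rV[R]_n -> R) => 'D_(basis_vec i) df) f s.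

Definition schwartz f : Prop := forall s : seq 'I_n,
  (forall x, differentiable (iter_partial s f) x) /\
  (forall N : nat, exists C : R, forall x,
     (1 + enorm x) ^+ N * `|iter_partial s f x| <= C).

(* \hat f(k) = \int f(x) e^{-i k.x} dx *)
Definition fourier f k : R[i] :=
  integralC (fun x => (f x)%:C * (cos (dot k x) -i* sin (dot k x))).

(* The Fourier transform of f, in the sense of tempered distributions, is the
   function h. Real test functions suffice: both pairings are C-linear. *)
Definition has_fourier f h : Prop := forall phi, schwartz phi ->
  [/\ integrableC (fun x => (f x)%:C * fourier phi x),
      integrableC (fun k => h k * (phi k)%:C) &
      integralC (fun x => (f x)%:C * fourier phi x) =
      integralC (fun k => h k * (phi k)%:C)].

(* w = (-Delta)^alpha f, the Fourier multiplier with symbol |k|^(2 alpha). *)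
Definition is_frac_laplacian (alpha : R) f (w : 'rV[R]_n -> R) : Prop :=
  exists2 h, has_fourier f h &
    has_fourier w (fun k => (enorm k `^ (2 * alpha))%:C * h k).

Definition divergence (v : 'rV[R]_n -> 'rV[R]_n) x : R :=
  \sum_i ('D_(basis_vec i) v x) 0 i.

Definition gradient f x : 'rV[R]_n := \row_i 'D_(basis_vec i) f x.

Definition advection (u v : 'rV[R]_n -> 'rV[R]_n) x : 'rV[R]_n :=
  \sum_j u x 0 j *: 'D_(basis_vec j) v x.

(* Derivative at t relative to J; it is one-sided at an endpoint of J. *)
Definition has_derivative_in (J : set R) (f : R -> 'rV[R]_n) (t : R)
    (v : 'rV[R]_n) : Prop :=
  (s - t)^-1 *: (f s - f t) @[s --> within J (t^')] --> v.

(* Classical solutions on the time interval J. *)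
Definition ns_solution (alpha : R) (J : set R)
    (u : R -> 'rV[R]_n -> 'rV[R]_n) : Prop :=
  exists (p : R -> 'rV[R]_n -> R) (w ut : R -> 'rV[R]_n -> 'rV[R]_n),
  forall t, J t ->
    (forall i, is_frac_laplacian alpha (fun x => u t x 0 i)
                                       (fun x => w t x 0 i)) /\
    forall x,
      [/\ differentiable (u t) x, differentiable (p t) x,
          has_derivative_in J (u ^~ x) t (ut t x),
          ut t x + advection (u t) (u t) x + gradient (p t) x = - w t x &
          divergence (u t) x = 0].

Definition kinetic_energy (v : 'rV[R]_n -> 'rV[R]_n) : \bar R :=
  ((2^-1)%:E *
   'N[lebesgue_Rn R n]_2%:E[(fun t => (enorm (v (vec t)))%:E)] ^+ 2)%E.

End EuclideanSpace.

Section Scaling.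
Context (R : realType) (n : nat).

Definition space_scale (alpha lambda : R) : R :=
  lambda `^ (1 / (2 * alpha - 1)).

Definition time_scale (alpha lambda : R) : R :=
  lambda `^ (2 * alpha / (2 * alpha - 1)).

Definition rescale (alpha lambda : R) (u : R -> 'rV[R]_n -> 'rV[R]_n) :
    R -> 'rV[R]_n -> 'rV[R]_n := fun t x =>
  lambda^-1 *: u (t / time_scale alpha lambda)
                 ((space_scale alpha lambda)^-1 *: x).

Definition time_interval (J : set R) : Prop :=
  is_interval J /\ exists a b, [/\ J a, J b & a < b].

Definition rescale_time (alpha lambda : R) (J : set R) : set R :=
  [set time_scale alpha lambda * t | t in J].

End Scaling.

(* Main.v *)
(* Dilation by c multiplies Lebesgue measure on R^n by c^n, so the Fourier
   transform of f(c .) is c^-n h(./c) when that of f is h, and the fractional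
   Laplacian commutes with f |-> f(c .) up to the factor c^(2 alpha).  With
   L = lambda^(1/(2 alpha - 1)) and T = lambda L = L^(2 alpha), all terms of the
   equation for u_lambda carry the same factor 1/(lambda T), the pressure being
   rescaled as lambda^-2 p(x/L, t/T).  The kinetic energy is multiplied by
   lambda^-2 L^n = lambda^(n/(2 alpha - 1) - 2), which is 1 for all lambda
   exactly when n = 2 (2 alpha - 1). *)

Require Import Defs.
From HB Require Import structures.
From mathcomp Require Import all_boot all_order all_algebra.
From mathcomp Require Import complex.
From mathcomp Require Import all_classical all_reals all_analysis.
From mathcomp Require Import measurable_realfun.
From mathcomp Require Import ring lra.

Set Implicit Arguments.
Unset Strict Implicit.
Unset Printing Implicit Defensive.

Import Order.TTheory GRing.Theory Num.Theory.
Import numFieldNormedType.Exports.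

Local Open Scope classical_set_scope.
Local Open Scope ring_scope.

(** * Change of variables for a bijection that scales a measure by a constant *)

Section ScalingTransfer.
Local Open Scope ereal_scope.
Context d (T : measurableType d) (R : realType).
Variables (mu : {measure set T -> \bar R}) (c : R) (s s' : T -> T).
Hypotheses (c0 : (0 < c)%R) (ms : measurable_fun setT s)
  (ms' : measurable_fun setT s') (sK : cancel s s') (s'K : cancel s' s)
  (mus : forall A, measurable A -> mu (s @^-1` A) = c%:E * mu A).
Import HBNNSimple.

Lemma nnsfun_comp_exists (f : T -> T) (h : {nnsfun T >-> R}) :
  measurable_fun setT f -> exists g : {nnsfun T >-> R}, g =1 h \o f.
Proof.
move=> mf; pose g : T -> R := h \o f.
have mg : measurable_fun setT g by exact: measurableT_comp.
have fg : finite_set (range g).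
  by apply: sub_finite_set (fimfunP h) => _ [x _ <-]; exists (f x).
have g0 x : (0 <= g x)%R by [].
pose m1 := isMeasurableFun.Build _ _ _ _ g mg.
pose m2 := @FiniteImage.Build _ _ g fg.
pose m3 := @isNonNegFun.Build _ _ g g0.
pose G : {nnsfun T >-> R} := HB.pack g m1 m2 m3.
by exists G.
Qed.

(** The fibre of [h \o s] over a value is the preimage under [s] of the fibre of [h], so [mus]
    scales every term of the finite sum by [c]. *)
Lemma sintegral_scaling (h g : {nnsfun T >-> R}) : g =1 h \o s ->
  sintegral mu g = c%:E * sintegral mu h.
Proof.
move=> /funext gE; rewrite !sintegralET ge0_mule_fsumr; last first.
  exact: nnsfun_mulemu_ge0.
apply: eq_fsbigr => x _; rewrite muleCA; congr (_ * _).
by rewrite gE comp_preimage mus.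
Qed.

(** The supremum behind the integral of a nonnegative function; [integral] is the difference of its
    values at [f^\+] and [f^\-]. *)
Let nnint (f : T -> \bar R) := ereal_sup [set sintegral mu h |
  h in [set h : {nnsfun T >-> R} | forall x, (h x)%:E <= f x]].

(** Composition with [s] carries simple functions below [f] to simple functions below [f \o s], and
    composition with [s'] carries them back. *)
Let nnint_scaling (f : T -> \bar R) : nnint (f \o s) = c%:E * nnint f.
Proof.
rewrite /nnint -ereal_sup_pZl//; congr ereal_sup; apply/seteqP; split.
  move=> _ [h /= hf <-]; have [g gE] := nnsfun_comp_exists h ms'.
  exists (sintegral mu g).
    by exists g => //= x; have := hf (s' x); rewrite gE/= s'K.
  by rewrite -(@sintegral_scaling g h)// => x /=; rewrite gE/= sK.
move=> _ [_ [h /= hf <-] <-]; have [g gE] := nnsfun_comp_exists h ms.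
exists g; last exact: sintegral_scaling.
by move=> x /=; rewrite gE; exact: hf.
Qed.

(* No measurability of [f] is required: composition with the bimeasurable
   bijection [s] permutes the simple functions below the integrand. *)
Lemma integral_scaling (f : T -> \bar R) :
  \int[mu]_x f (s x) = c%:E * \int[mu]_x f x.
Proof.
have nnint_ge0 g : (forall x, 0 <= g x) -> 0 <= nnint g.
  move=> g0; apply: ereal_sup_ubound; exists nnsfun0; last exact: sintegral0.
  by move=> x /=; exact: g0.
rewrite /integral !patch_setT.
change (nnint (f \o s)^\+ - nnint (f \o s)^\- =
        c%:E * (nnint f^\+ - nnint f^\-)).
rewrite funepos_comp funeneg_comp !nnint_scaling.
have := nnint_ge0 _ (funepos_ge0 f); have := nnint_ge0 _ (funeneg_ge0 f).
(* Neither supremum is [-oo], and a positive [c] preserves infinities, so both sides agree even for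
   [+oo - +oo]. *)
case: (nnint f^\+) => [a| |] //; case: (nnint f^\-) => [b| |] // _ _;
  rewrite ?(gt0_muley,gt0_muleNy) ?lte_fin//.
by rewrite -EFinB -!EFinM -EFinB mulrBr.
Qed.

End ScalingTransfer.

(** * Positive constants in integrals of nonnegative functions *)

Section PositiveFactor.
Local Open Scope ereal_scope.
Context d (T : measurableType d) (R : realType).
Variables (mu : {measure set T -> \bar R}).
Import HBNNSimple.

(** Multiplication by [b], with inverse multiplication by [b^-1], matches the simple functions below
    [f] with those below [b * f]. *)
Lemma ge0_integral_pZl (b : R) (f : T -> \bar R) : (0 < b)%R ->
  (forall x, 0 <= f x) ->
  \int[mu]_x (b%:E * f x) = b%:E * \int[mu]_x f x.
Proof.
move=> b0 f0; have b0' := ltW b0; have bi0 : (0 <= b^-1)%R by rewrite invr_ge0.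
rewrite !ge0_integralTE// => [|x]; last by rewrite mule_ge0.
rewrite -ereal_sup_pZl//; congr ereal_sup; apply/seteqP; split.
  move=> _ [h /= hf <-]; exists (sintegral mu (scale_nnsfun h bi0)).
    exists (scale_nnsfun h bi0) => //= x.
    by rewrite EFinM lee_pdivrMl.
  by rewrite sintegralrM muleA -EFinM mulfV ?gt_eqF// mul1e.
move=> _ [_ [h /= hf <-] <-]; exists (scale_nnsfun h b0').
  by move=> x /=; rewrite EFinM lee_pmul2l.
by rewrite sintegralrM.
Qed.

End PositiveFactor.

(** * Dilations and Lebesgue measure *)

Section Dilation.
Context (R : realType).
Local Notation mR := (measurableTypeR R).

Lemma measurable_scale (c : R) : measurable_fun [set: mR] ( *%R c : mR -> mR).
Proof. exact: mulrl_measurable. Qed.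

(** [c] times the image of Lebesgue measure under multiplication by [c] gives every []a, b]] its
    length, hence is Lebesgue measure by uniqueness. *)
Lemma lebesgue_measure_scale (c : R) (A : set mR) : 0 < c -> measurable A ->
  lebesgue_measure (( *%R c : mR -> mR) @^-1` A) =
    ((c^-1)%:E * lebesgue_measure A)%E.
Proof.
move=> c0 mA.
pose m := mscale (NngNum (ltW c0))
  (pushforward lebesgue_measure ( *%R c : mR -> mR)).
have -> : lebesgue_measure A = m (measurable_scale c) A.
  apply: lebesgue_measure_unique => // _ [[a b]] _ <-.
  transitivity (c%:E * lebesgue_measure `](c^-1 * a)%R, (c^-1 * b)%R]%classic)%E.
    rewrite !lebesgue_measure_itv/= !lte_fin ltr_pM2l ?invr_gt0//.
    case: ifPn => _; last by rewrite mule0.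
    by rewrite -!EFinB -EFinM -mulrBr mulrA divff ?gt_eqF// mul1r.
  congr (_ * lebesgue_measure _)%E; apply/seteqP.
  by split=> x /=; rewrite !in_itv/= ![c^-1 * _]mulrC ltr_pdivrMr//
    ler_pdivlMr// ![x * c]mulrC.
by rewrite /m /mscale /pushforward/= muleA -EFinM mulVf ?gt_eqF// mul1e.
Qed.

Definition dilate (c : R) n (t : n.-tuple mR) : n.-tuple mR :=
  [tuple of map ( *%R c) t].

Lemma measurable_dilate c n : measurable_fun setT (@dilate c n).
Proof.
apply/measurable_fun_tnthP => i.
rewrite (_ : _ \o _ = ( *%R c : mR -> mR) \o (fun t : n.-tuple mR => tnth t i)).
  by apply: measurableT_comp; [exact: measurable_scale|exact: measurable_tnth].
by apply/funext => t /=; rewrite tnth_map.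
Qed.

Lemma dilateK c n : c != 0 -> cancel (@dilate c n) (@dilate c^-1 n).
Proof.
move=> c0 t; apply: eq_from_tnth => i.
by rewrite !tnth_map mulrA mulVf// mul1r.
Qed.

Lemma dilateVK c n : c != 0 -> cancel (@dilate c^-1 n) (@dilate c n).
Proof. by move=> c0 t; rewrite -{1}[c]invrK dilateK// invr_eq0. Qed.

(** Induction on the dimension: the sections contribute [c ^- n], and the change of variable on the
    line contributes one more [c^-1]. *)
Lemma lebesgue_Rn_dilate c n (A : set (n.-tuple mR)) : 0 < c -> measurable A ->
  lebesgue_Rn R n (@dilate c n @^-1` A) = ((c ^- n)%:E * lebesgue_Rn R n A)%E.
Proof.
move=> c0; have cN0 : c != 0 by rewrite gt_eqF.
elim: n A => [|n IH] A mA.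
  (* In dimension 0 there is only one tuple, so the dilation is the identity. *)
  rewrite expr0 invr1 mul1e; congr (lebesgue_Rn _ _ _).
  by apply/funext => t; rewrite /preimage/= (tuple0 (dilate c t)) (tuple0 t).
have mB : measurable (@tuple_cons R n @^-1` A).
  by rewrite -[X in measurable X]setTI; exact: measurable_tuple_cons.
rewrite /= /lebesgue_step /pushforward /product_measure1.
set B := _ @^-1` A in mB *.
(* The section at [x] of the dilated set is the dilation preimage of the section of [B] at
   [c * x]. *)
transitivity (\int[lebesgue_measure]_x
    ((c ^- n)%:E * lebesgue_Rn R n (xsection B (c * x)%R)))%E.
  apply: eq_integral => x _ /=.
  rewrite -IH; last exact: measurable_xsection.
  congr (lebesgue_Rn _ _ _); apply/seteqP; split=> t;
    rewrite /xsection/= !inE /B/=.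
  - by rewrite (_ : dilate _ _ = tuple_cons (c * x, dilate c t))//; apply: val_inj.
  - by rewrite (_ : dilate _ _ = tuple_cons (c * x, dilate c t))//; apply: val_inj.
have mx : measurable_fun [set: mR] (lebesgue_Rn R n \o xsection B).
  exact: measurable_fun_xsection.
rewrite (@integral_scaling _ _ _ lebesgue_measure c^-1 ( *%R c) ( *%R c^-1)
  _ _ _ _ _ _ (fun x => ((c ^- n)%:E * lebesgue_Rn R n (xsection B x))%E)).
- rewrite ge0_integralZl//; last by rewrite lee_fin invr_ge0 exprn_ge0// ltW.
  by rewrite muleA -EFinM exprS invfM.
- by rewrite invr_gt0.
- exact: measurable_scale.
- exact: measurable_scale.
- by move=> x; rewrite mulrA mulVf// mul1r.
- by move=> x; rewrite mulrA mulfV// mul1r.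
- by move=> D mD; exact: lebesgue_measure_scale.
Qed.

Lemma integral_dilate c n (f : n.-tuple mR -> \bar R) : 0 < c ->
  (\int[lebesgue_Rn R n]_t f (dilate c t) =
   (c ^- n)%:E * \int[lebesgue_Rn R n]_t f t)%E.
Proof.
move=> c0; have cN0 : c != 0 by rewrite gt_eqF.
apply: (@integral_scaling _ _ _ _ _ _ (@dilate c^-1 n)).
- by rewrite invr_gt0 exprn_gt0.
- exact: measurable_dilate.
- exact: measurable_dilate.
- exact: dilateK.
- exact: dilateVK.
- by move=> A mA; exact: lebesgue_Rn_dilate.
Qed.

Lemma integrable_dilate c n (f : n.-tuple mR -> \bar R) : 0 < c ->
  (lebesgue_Rn R n).-integrable setT f ->
  (lebesgue_Rn R n).-integrable setT (fun t => f (dilate c t)).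
Proof.
move=> c0 /integrableP[mf fi]; apply/integrableP; split.
  exact: (measurableT_comp mf (@measurable_dilate c n)).
rewrite (integral_dilate (fun t => `|f t|%E))// lte_mul_pinfty//.
by rewrite lee_fin invr_ge0 exprn_ge0// ltW.
Qed.

Lemma vec_dilate c n (t : n.-tuple mR) : vec (dilate c t) = c *: vec t.
Proof. by apply/rowP => i; rewrite !mxE tnth_map. Qed.

End Dilation.

(** * Chain rule for dilations *)

Section DilatedDerivatives.
Context (R : realType) (n : nat) (W : normedModType R).
Implicit Types (f : 'rV[R]_n -> W) (x v : 'rV[R]_n) (b c : R).

Lemma differentiable_dilate f b c x : differentiable f (c *: x) ->
  differentiable (fun y => b *: f (c *: y)) x.
Proof.
move=> df; apply: (@differentiableZ _ _ _ (f \o *:%R c)).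
by apply: differentiable_comp.
Qed.

Lemma derive_dilate f b c x v : differentiable f (c *: x) ->
  'D_v (fun y => b *: f (c *: y)) x = (b * c) *: 'D_v f (c *: x).
Proof.
move=> df; have dc : differentiable ( *:%R c : 'rV[R]_n -> 'rV[R]_n) x by [].
have dfc : differentiable (f \o *:%R c) x by exact: differentiable_comp.
rewrite !deriveE//; last exact: differentiable_dilate.
(* The differentials are compared as functions and then evaluated at the direction [v]. *)
have dscale : 'd ( *:%R c : 'rV[R]_n -> 'rV[R]_n) x v = c *: v.
  have E := @diff_val _ _ _ _ _ _ _ (is_diff_scaler c x).
  exact: (congr1 (fun F => F v) E).
have dE : 'd (f \o *:%R c) x v =
    'd f (c *: x) ('d ( *:%R c : 'rV[R]_n -> 'rV[R]_n) x v).
  exact: (congr1 (fun F => F v) (diff_comp dc df)).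
have ZE : 'd (b *: (f \o *:%R c)) x v = b *: 'd (f \o *:%R c) x v.
  exact: (congr1 (fun F => F v) (diffZ b dfc)).
rewrite -scalerA; apply: etrans ZE _; congr (_ *: _).
by apply: etrans dE _; rewrite dscale; exact: linearZ.
Qed.

End DilatedDerivatives.

(** * Fourier transform and fractional Laplacian under dilation *)

Section DilatedFourier.
Context (R : realType) (n : nat).
Implicit Types (f w phi : 'rV[R]_n -> R) (g h : 'rV[R]_n -> R[i]).
Implicit Types (x k : 'rV[R]_n) (b c : R).
Local Open Scope complex_scope.

Lemma enorm_ge0 x : 0 <= enorm x.
Proof. exact: sqrtr_ge0. Qed.

Lemma enormZ c x : 0 <= c -> enorm (c *: x) = c * enorm x.
Proof.
move=> c0; rewrite /enorm; under eq_bigr do rewrite mxE exprMn.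
by rewrite -mulr_sumr sqrtrM ?sqr_ge0// sqrtr_sqr ger0_norm.
Qed.

Lemma iter_partial_dilate f c (s : seq 'I_n) x : schwartz f ->
  iter_partial s (fun y => f (c *: y)) x = c ^+ size s * iter_partial s f (c *: x).
Proof.
move=> sf; elim: s x => [|i s IH] x /=; first by rewrite mul1r.
rewrite -!/(iter_partial _ _).
have -> : iter_partial s (fun y => f (c *: y)) =
    fun y => c ^+ size s *: (iter_partial s f (c *: y) : R^o) by exact/funext.
by rewrite (@derive_dilate _ _ R (iter_partial s f)) ?exprSr//; apply: (sf s).1.
Qed.

Lemma schwartz_dilate f c : 0 < c -> schwartz f -> schwartz (fun y => f (c *: y)).
Proof.
move=> c0 sf s; have [df bf] := sf s; split.
  move=> x.
  have -> : iter_partial s (fun y => f (c *: y)) =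
      fun y => c ^+ size s *: (iter_partial s f (c *: y) : R^o).
    by apply/funext => y; exact: iter_partial_dilate.
  exact: (@differentiable_dilate _ _ R (iter_partial s f)).
move=> N; have [C CP] := bf N.
have M1 : 1 <= 1 + c^-1 by rewrite lerDl invr_ge0 ltW.
(* The weight costs [(1 + c^-1) ^+ N], by the bound [xc], and the derivatives cost [c ^+ size s]. *)
exists ((1 + c^-1) ^+ N * (c ^+ size s * C)) => x.
have xc : 1 + enorm x <= (1 + c^-1) * (1 + enorm (c *: x)).
  rewrite enormZ ?ltW// mulrDr mulr1 mulrDl mul1r mulrA mulVf ?gt_eqF// mul1r.
  have := enorm_ge0 x; have : 0 < c^-1 by rewrite invr_gt0.
  by have := mulr_ge0 (ltW c0) (enorm_ge0 x); lra.
rewrite iter_partial_dilate// normrM ger0_norm ?exprn_ge0 ?(ltW c0)//.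
apply: (@le_trans _ _ (((1 + c^-1) * (1 + enorm (c *: x))) ^+ N *
    (c ^+ size s * `|iter_partial s f (c *: x)|))).
  apply: ler_wpM2r; first by rewrite mulr_ge0// exprn_ge0// ltW.
  apply: lerXn2r => //; rewrite nnegrE ?mulr_ge0 ?addr_ge0 ?enorm_ge0//.
  by rewrite invr_ge0 ltW.
rewrite exprMn -mulrA ler_wpM2l ?exprn_ge0 ?(le_trans ler01)//.
by rewrite mulrCA ler_wpM2l ?exprn_ge0// ltW.
Qed.

Lemma fine_pmull (r : R) (x : \bar R) : 0 < r -> fine (r%:E * x)%E = r * fine x.
Proof.
by move=> r0; case: x => [x| |] //=; rewrite ?(gt0_muley,gt0_muleNy) ?lte_fin//= mulr0.
Qed.

Lemma ReZ (a : R) (z : R[i]) : complex.Re (a%:C * z) = a * complex.Re z.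
Proof. by case: z => x y /=; rewrite mul0r subr0. Qed.

Lemma ImZ (a : R) (z : R[i]) : complex.Im (a%:C * z) = a * complex.Im z.
Proof. by case: z => x y /=; rewrite mul0r addr0. Qed.

Lemma integrableC_dilate g b c : 0 < c -> integrableC g ->
  integrableC (fun x => b%:C * g (c *: x)).
Proof.
move=> c0 [Rg Ig]; split.
- under eq_fun do rewrite ReZ -vec_dilate EFinM.
  exact/integrableZl/(integrable_dilate c0 Rg).
- under eq_fun do rewrite ImZ -vec_dilate EFinM.
  exact/integrableZl/(integrable_dilate c0 Ig).
Qed.

(* [fine] sends infinite or undefined integrals to 0 on both sides, so no
   integrability is required. *)
Lemma integralC_dilate g c : 0 < c ->
  integralC (fun x => g (c *: x)) = (c ^- n)%:C * integralC g.
Proof.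
move=> c0; have cn : 0 < c ^- n by rewrite invr_gt0 exprn_gt0.
apply/eqP; rewrite eq_complex ReZ ImZ /integralC /Rintegral /=.
apply/andP; split; apply/eqP; under eq_integral do rewrite -vec_dilate.
- by rewrite (integral_dilate (fun t => (complex.Re (g (vec t)))%:E))// fine_pmull.
- by rewrite (integral_dilate (fun t => (complex.Im (g (vec t)))%:E))// fine_pmull.
Qed.

(** Here [b] may vanish or be negative, so linearity comes from integrability rather than from
    [fine_pmull]. *)
Lemma integralCZ g b : integrableC g ->
  integralC (fun x => b%:C * g x) = b%:C * integralC g.
Proof.
move=> [Rg Ig]; apply/eqP; rewrite eq_complex ReZ ImZ /integralC/=.
apply/andP; split; apply/eqP.
- by under eq_Rintegral do rewrite ReZ; rewrite RintegralZl.
- by under eq_Rintegral do rewrite ImZ; rewrite RintegralZl.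
Qed.

Lemma dotZl c x k : dot (c *: x) k = c * dot x k.
Proof. by rewrite /dot mulr_sumr; apply: eq_bigr => i _; rewrite mxE mulrA. Qed.

Lemma dotZr c x k : dot x (c *: k) = c * dot x k.
Proof. by rewrite /dot mulr_sumr; apply: eq_bigr => i _; rewrite mxE mulrCA. Qed.

(** Substitute [c^-1 *: y] for [y] in the right-hand integral: the phase is unchanged because the
    factors [c] and [c^-1] cancel in [dot]. *)
Lemma fourier_dilate f c x : 0 < c ->
  fourier f x = (c ^+ n)%:C * fourier (fun y => f (c *: y)) (c *: x).
Proof.
move=> c0; have ci0 : 0 < c^-1 by rewrite invr_gt0.
have cN0 : c != 0 by rewrite gt_eqF.
rewrite /fourier -[c ^+ n]invrK -exprVn -integralC_dilate//.
congr integralC; apply/funext => y; rewrite scalerA mulfV// scale1r.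
by rewrite dotZl dotZr mulrA mulfV// mul1r.
Qed.

(** The dilation is moved onto the test function: [psi], the dilate of [phi], is again Schwartz, and
    both pairings with [phi] become [b] times the corresponding pairing of [f] or [h] with [psi]. *)
Lemma has_fourier_dilate f h b c : 0 < c -> has_fourier f h ->
  has_fourier (fun x => b * f (c *: x))
              (fun k => (b * c ^- n)%:C * h (c^-1 *: k)).
Proof.
move=> c0 fh phi sphi; have ci0 : 0 < c^-1 by rewrite invr_gt0.
have cN0 : c != 0 by rewrite gt_eqF.
have cnN0 : c ^+ n != 0 by rewrite expf_eq0 (negbTE cN0) andbF.
have [fi hi fhE] := fh _ (schwartz_dilate c0 sphi).
set psi := fun y => phi (c *: y) in fi hi fhE.
pose G x := (f x)%:C * fourier psi x.
pose H k := h k * (psi k)%:C.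
have GE : (fun x => (b * f (c *: x))%:C * fourier phi x) =
    fun x => (b * c ^+ n)%:C * G (c *: x).
  by apply/funext => x; rewrite (fourier_dilate phi x c0) /G !rmorphM/=; ring.
have HE : (fun k => (b * c ^- n)%:C * h (c^-1 *: k) * (phi k)%:C) =
    fun k => (b * c ^- n)%:C * H (c^-1 *: k).
  by apply/funext => k; rewrite /H /psi scalerA mulfV// scale1r mulrA.
have integrableZ1 (F : 'rV[R]_n -> R[i]) e : 0 < e -> integrableC F ->
    integrableC (fun x => F (e *: x)).
  move=> e0 /(integrableC_dilate 1 e0).
  by under eq_fun do rewrite mul1r.
rewrite GE HE.
split.
- exact: integrableC_dilate.
- exact: integrableC_dilate.
- rewrite integralCZ; last exact: integrableZ1.
  rewrite integralCZ; last exact: integrableZ1.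
  rewrite !integralC_dilate// fhE !mulrA -!rmorphM/=.
  by congr (_%:C * _); rewrite exprVn invrK -!mulrA mulfV// mulVf.
Qed.

(** The symbol is homogeneous of degree [2 * alpha]: its value at [k] is [c] to that power times its
    value at [c^-1 *: k]. *)
Lemma is_frac_laplacian_dilate alpha f w b c : 0 < c ->
  is_frac_laplacian alpha f w ->
  is_frac_laplacian alpha (fun x => b * f (c *: x))
    (fun x => b * c `^ (2 * alpha) * w (c *: x)).
Proof.
move=> c0 [h fh wh]; exists (fun k => (b * c ^- n)%:C * h (c^-1 *: k)).
  exact: has_fourier_dilate.
have := has_fourier_dilate (b * c `^ (2 * alpha)) c0 wh.
rewrite (_ : (fun k => _ * (_ * _)) = (fun k => (enorm k `^ (2 * alpha))%:C *
  ((b * c ^- n)%:C * h (c^-1 *: k))))//; apply/funext => k.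
have ci0 : 0 <= c^-1 by rewrite invr_ge0 ltW.
rewrite enormZ// powRM ?enorm_ge0//.
have c2 : c `^ (2 * alpha) * c^-1 `^ (2 * alpha) = 1.
  by rewrite -powRM ?(ltW c0)// mulfV ?gt_eqF// powR1.
rewrite !mulrA -!rmorphM/=; congr (_%:C * _).
transitivity (c `^ (2 * alpha) * c^-1 `^ (2 * alpha) *
  (enorm k `^ (2 * alpha) * b * c ^- n)); first by ring.
by rewrite c2 mul1r mulrA.
Qed.

End DilatedFourier.

(** * Rescaled solutions of the equations *)

Section RescaledSolutions.
Context (R : realType) (n : nat).

(** The difference quotient at [T * t] is [b / T] times that of [f] at [t], taken at [s / T]. *)
Lemma has_derivative_in_rescale (J : set R) (f : R -> 'rV[R]_n) (t b T : R) v :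
  0 < T -> has_derivative_in J f t v ->
  has_derivative_in [set T * r | r in J] (fun r => b *: f (r / T)) (T * t)
    ((b * T^-1) *: v).
Proof.
move=> T0 ft; have TN0 : T != 0 by rewrite gt_eqF.
rewrite /has_derivative_in.
have -> : (fun s => (s - T * t)^-1 *: (b *: f (s / T) - b *: f (T * t / T))) =
    (fun s => (b * T^-1) *: ((s / T - t)^-1 *: (f (s / T) - f t))).
  apply/funext => s.
  rewrite (mulrC T t) mulfK// -scalerBr !scalerA; congr (_ *: _).
  rewrite -(mulrA b) -invfM mulrBr [T * (s / T)]mulrCA mulfV// mulr1 (mulrC t).
  exact: mulrC.
apply: cvgZr.
apply: (@cvg_comp _ _ _ (fun s => s / T)
  (fun r => (r - t)^-1 *: (f r - f t)) _ (within J (t^')) _ _ ft).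
(* Division by [T] sends punctured neighbourhoods of [T * t] relative to the scaled interval into
   those of [t] relative to [J]. *)
move=> A; rewrite /within/= => At.
have cT : (s / T @[s --> T * t] --> t).
  by rewrite -{2}(mulfK TN0 t) (mulrC t); apply: cvgM; [exact: cvg_id|exact: cvg_cst].
have := cT _ At; rewrite /= !nbhs_simpl /=.
apply: filterS => s /= sA sN [r Jr rs].
apply: sA; last by rewrite -rs (mulrC T) mulfK.
by apply: contra_neq sN => <-; rewrite mulrCA mulfV// mulr1.
Qed.

Variables (alpha lambda : R).
Hypotheses (a12 : alpha <> 1 / 2) (l0 : 0 < lambda).
Local Notation L := (space_scale alpha lambda).
Local Notation T := (time_scale alpha lambda).

Lemma two_alpha_neq1 : 2 * alpha - 1 != 0.
Proof. by apply/eqP => h; apply: a12; lra. Qed.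

Lemma space_scale_gt0 : 0 < L. Proof. exact: powR_gt0. Qed.

Lemma time_scale_gt0 : 0 < T. Proof. exact: powR_gt0. Qed.

(** The exponents satisfy [1 + 1 / (2 alpha - 1) = 2 alpha / (2 alpha - 1)]. This gives the
    advection and pressure terms the factor of the time derivative; [space_scale_power] does so for
    the dissipation. *)
Lemma time_scaleE : T = lambda * L.
Proof.
rewrite /time_scale /space_scale -{2}(powRr1 (ltW l0)) -powRD; last first.
  by rewrite (gt_eqF l0) implybT.
by congr powR; field; exact: two_alpha_neq1.
Qed.

Lemma space_scale_power : L^-1 `^ (2 * alpha) = T^-1.
Proof.
rewrite /time_scale /space_scale -!powRN -powRrM; congr powR.
by field; exact: two_alpha_neq1.
Qed.

Lemma ns_solution_rescale (J : set R) (u : R -> 'rV[R]_n -> 'rV[R]_n) :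
  ns_solution alpha J u ->
  ns_solution alpha (rescale_time alpha lambda J) (rescale alpha lambda u).
Proof.
have L0 := space_scale_gt0; have T0 := time_scale_gt0.
have Li0 : 0 < L^-1 by rewrite invr_gt0.
have lT : lambda^-1 * L^-1 = T^-1 by rewrite -invfM -time_scaleE.
move=> [p [w [ut sol]]].
exists (fun t x => lambda^-1 ^+ 2 * p (t / T) (L^-1 *: x)),
  (fun t x => (lambda^-1 * T^-1) *: w (t / T) (L^-1 *: x)),
  (fun t x => (lambda^-1 * T^-1) *: ut (t / T) (L^-1 *: x)).
move=> _ [t Jt <-]; have [lap eqs] := sol t Jt.
have Tt : T * t / T = t by rewrite mulrC mulKf// gt_eqF.
rewrite /rescale Tt; split.
  move=> i; have := is_frac_laplacian_dilate lambda^-1 Li0 (lap i).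
  rewrite space_scale_power.
  by congr (is_frac_laplacian _ _ _); apply/funext => x; rewrite mxE.
move=> x; have [du dp dt eqn div0] := eqs (L^-1 *: x).
split.
- exact: differentiable_dilate.
- exact: (@differentiable_dilate _ _ R).
- exact: (has_derivative_in_rescale (b := lambda^-1) T0 dt).
(* Two factors [lambda^-1] from the velocities and one [L^-1] from the derivative combine to
   [lambda^-1 * T^-1]. *)
- have -> : advection (fun x => lambda^-1 *: u t (L^-1 *: x))
      (fun x => lambda^-1 *: u t (L^-1 *: x)) x =
      (lambda^-1 * T^-1) *: advection (u t) (u t) (L^-1 *: x).
    rewrite /advection scaler_sumr; apply: eq_bigr => j _.
    by rewrite derive_dilate// mxE lT !scalerA mulrAC.
  have -> : gradient (fun x => lambda^-1 ^+ 2 * p t (L^-1 *: x)) x =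
      (lambda^-1 * T^-1) *: gradient (p t) (L^-1 *: x).
    apply/rowP => j; rewrite !mxE.
    by rewrite (@derive_dilate _ _ R (p t))// -lT mulrA.
  by rewrite -!scalerDr eqn scalerN.
- rewrite /divergence.
  under eq_bigr do rewrite derive_dilate// mxE.
  by rewrite -mulr_sumr -/(divergence _ _) div0 mulr0.
Qed.

(** * Kinetic energy under rescaling *)

(** Undoes the square root in the L2 norm when it is squared, also for infinite energy. *)
Lemma poweR_half_mul (x : \bar R) :
  (0 <= x -> x `^ 2^-1 * x `^ 2^-1 = x)%E.
Proof.
move=> x0; have half0 : (2^-1 : R) != 0 by [].
case: x x0 => [r| |] //= r0; last by rewrite (negbTE half0) mulyy.
have half1 : (2^-1 + 2^-1 : R) = 1 by lra.
by rewrite -EFinM -powRD half1 ?powRr1// oner_eq0.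
Qed.

Lemma kinetic_energyE (v : 'rV[R]_n -> 'rV[R]_n) :
  kinetic_energy v =
  ((2^-1)%:E * \int[lebesgue_Rn R n]_t (enorm (v (vec t)) ^+ 2)%:E)%E.
Proof.
rewrite /kinetic_energy; congr (_ * _)%E; rewrite unlock /=.
rewrite poweR_half_mul; last first.
  by apply: integral_ge0 => t _; rewrite lee_fin powR_ge0.
by apply: eq_integral => t _ /=; rewrite powR_mulrn// ger0_norm ?enorm_ge0.
Qed.

Lemma kinetic_energy_dilate (v : 'rV[R]_n -> 'rV[R]_n) (b c : R) :
  0 < b -> 0 < c ->
  kinetic_energy (fun x => b *: v (c *: x)) =
  ((b ^+ 2 * c ^- n)%:E * kinetic_energy v)%E.
Proof.
move=> b0 c0; rewrite !kinetic_energyE muleCA; congr (_ * _)%E.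
under eq_integral do rewrite enormZ ?(ltW b0)// -vec_dilate exprMn.
rewrite (integral_dilate (fun t => (b ^+ 2 * enorm (v (vec t)) ^+ 2)%:E))//.
under eq_integral do rewrite EFinM.
rewrite ge0_integral_pZl ?exprn_gt0//.
  by rewrite muleA -EFinM mulrC.
by move=> t; rewrite lee_fin sqr_ge0.
Qed.

Lemma kinetic_energy_rescale (u : R -> 'rV[R]_n -> 'rV[R]_n) (t : R) :
  kinetic_energy (rescale alpha lambda u (T * t)) =
  ((lambda `^ (n%:R / (2 * alpha - 1) - 2))%:E * kinetic_energy (u t))%E.
Proof.
rewrite /rescale [T * t / T]mulrC mulKf ?(gt_eqF time_scale_gt0)//.
rewrite kinetic_energy_dilate ?invr_gt0// ?space_scale_gt0//; congr (_%:E * _)%E.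
(* The factor [lambda ^- 2 * L ^+ n] is collected into one real power of [lambda]. *)
rewrite !exprVn invrK /space_scale -!powR_mulrn ?powR_ge0 ?(ltW l0)//.
rewrite -powRrM -powRN -powRD; last by rewrite (gt_eqF l0) implybT.
by congr powR; rewrite div1r addrC; congr (_ - _); exact: mulrC.
Qed.

Lemma critical_exponent :
  n%:R / (2 * alpha - 1) = 2 <-> alpha = (2 + n%:R) / 4.
Proof.
have a0 := two_alpha_neq1; split=> [/(canRL (divfK a0))|aE]; first by lra.
have -> : n%:R = 2 * (2 * alpha - 1) by rewrite aE; field.
by rewrite mulfK.
Qed.

End RescaledSolutions.

Theorem theorem4p1 (R : realType) (n : nat) (alpha : R)
    (hn : (2 <= n)%N) (alpha_gt0 : 0 < alpha) (alpha_neq : alpha <> 1 / 2)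
    (J : set R) (hJ : time_interval J)
    (u : R -> 'rV[R]_n -> 'rV[R]_n) (hu : ns_solution alpha J u) :
  (forall lambda : R, 0 < lambda ->
     ns_solution alpha (rescale_time alpha lambda J) (rescale alpha lambda u)) /\
  (forall T : R, J T ->
     (0 < kinetic_energy (u T))%E -> (kinetic_energy (u T) < +oo)%E ->
     ((forall lambda : R, 0 < lambda ->
         kinetic_energy (rescale alpha lambda u (time_scale alpha lambda * T)) =
         kinetic_energy (u T))
      <-> alpha = (2 + n%:R) / 4)).
Proof.
split=> [lambda l0|T JT E0 Eoo]; first exact: ns_solution_rescale.
rewrite -critical_exponent//; split=> [inv|crit lambda l0]; last first.
  by rewrite kinetic_energy_rescale// crit subrr powRr0 mul1e.
(* One value of [lambda] suffices: at [lambda = e] the logarithm of the energy factor is the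
   exponent itself. *)
have := inv _ (expR_gt0 1); rewrite kinetic_energy_rescale ?expR_gt0//.
(* The energy is a positive real [e], so it can be cancelled. *)
move: E0 Eoo; case: (kinetic_energy (u T)) => [e| |]//; rewrite lte_fin => e0 _.
move=> [/(canRL (mulfK (lt0r_neq0 e0)))]; rewrite divff ?gt_eqF// => /(congr1 (@ln R)).
by rewrite ln_powR expRK mulr1 ln1 => /eqP; rewrite subr_eq0 => /eqP.
Qed.
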